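(* There exists a sequence of even univariate real analytic functions $G_n:\mathbb R\to\mathbb R$, $n=1,2,\ldots$, with the following property. For all integers $d\ge 1$ and $n\ge 1$ and every nonzero polynomial $P\in\mathbb R[x_1,\ldots,x_d]$ of degree $n$, at least one of the points of the unit ball $B^d\subset\mathbb R^d$ at which the absolute value of the expression $P(x)G_n(|x|)$ attains its maximum on $B^d$ is at distance at least $\frac1n$ from the zero set of the polynomial $P$.
   Context: $B^d=\{x\in\mathbb R^d : |x|\le 1\}$ is the closed unit ball, where $|\cdot|$ is the Euclidean norm. The zero set of $P$ is $\{x\in\mathbb R^d : P(x)=0\}$. Distance is Euclidean; ''a point is at distance at least $r$ from a set $Z$'' means that every point of $Z$ is at distance at least $r$ from it (vacuously true if $Z$ is empty). *)

(* Defs.v *)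
From HB Require Import structures.
From mathcomp Require Import all_boot all_order all_algebra.
From mathcomp Require Import mpoly.
From mathcomp Require Import all_classical all_reals all_analysis.

Set Implicit Arguments.
Unset Strict Implicit.
Unset Printing Implicit Defensive.

Import Order.TTheory GRing.Theory Num.Theory.
Import numFieldTopology.Exports numFieldNormedType.Exports.

Local Open Scope classical_set_scope.
Local Open Scope ring_scope.

(* The norm that the library puts on row vectors is the sup norm. *)
Definition enorm (R : realType) (d : nat) (x : 'rV[R]_d) : R :=
  Num.sqrt (\sum_(i < d) x 0 i ^+ 2).

Definition unit_ball (R : realType) (d : nat) : set 'rV[R]_d :=
  [set x | enorm x <= 1].

Definition peval (R : realType) (d : nat) (P : {mpoly R[d]}) (x : 'rV[R]_d) : R :=
  P.@[fun i => x 0 i].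

Definition zero_set (R : realType) (d : nat) (P : {mpoly R[d]}) : set 'rV[R]_d :=
  [set x | peval P x = 0].

Definition dist_from_ge (R : realType) (d : nat) (r : R) (x : 'rV[R]_d)
    (Z : set 'rV[R]_d) : Prop :=
  forall z, Z z -> r <= enorm (x - z).

Definition attains_max_on (R : realType) (T : Type) (A : set T) (f : T -> R)
    (x : T) : Prop :=
  A x /\ forall y, A y -> f y <= f x.

Definition even_function (R : realType) (f : R -> R) : Prop :=
  forall x, f (- x) = f x.

Definition real_analytic (R : realType) (f : R -> R) : Prop :=
  forall x0 : R, exists (a : R^nat) (r : R), 0 < r /\
    forall x : R, `|x - x0| < r -> pseries a (x - x0) @ \oo --> f x.

(* Main.v *)
Require Import Defs.
From mathcomp Require Import all_boot all_order all_algebra.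
From mathcomp Require Import mpoly.
From mathcomp Require Import all_classical all_reals all_analysis.
From mathcomp Require Import zify ring lra.

Set Implicit Arguments.
Unset Strict Implicit.
Unset Printing Implicit Defensive.

Import Order.TTheory GRing.Theory Num.Theory.
Import numFieldTopology.Exports numFieldNormedType.Exports.

Local Open Scope ring_scope.

(** The model is the sphere.  If the restriction of a function F to every great
    circle of a sphere of radius r is a trigonometric polynomial of degree N
    and |F| is maximal at X, then every zero of F is at geodesic distance at
    least r pi / (2 N) from X: by M. Riesz's theorem, a trigonometric
    polynomial of degree N descends from a maximum of its absolute value no
    faster than a cosine of frequency N ([trigpoly_max_zero],
    [sphere_max_zero]).

    To localise the maximum, let P have degree n and lift the ball of radius r
    in R^d to the sphere of radius r in R^(d+1).  Multiply P by m factors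
    1 - a_j |x|^2, each vanishing on a parallel of the sphere, so that the
    total degree is N = n + 2 m, and choose r with r pi / (2 N) = 1 / n.  Then
    m bands of geodesic half-width just below 1 / n, centred at these
    parallels, cover everything between the equator and a polar cap of radius
    just above 1.  The maximum cannot lie in a band, whose centre would be a
    zero too close to it.  Hence it lies in the cap, at geodesic distance at
    least 1 / n from the zeros of P ([near_unit_maximizer_exists]).

    Letting m tend to infinity flattens the sphere: the cap becomes the unit
    ball, geodesic distance becomes Euclidean distance ([lift_distance]), and
    the product of the factors, which depends on n and m only, becomes G_n.
    The a_j are O(n^2 / (j + 1)^2) uniformly in m, so the coefficients of
    the products satisfy Cauchy estimates of every radius.  All limits are
    taken along one fixed ultrafilter on the indices m: bounded coefficients
    and maximum points then converge without passing to subsequences, the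
    products converge to an entire even function ([ultra_quad_prod_limit]),
    and the limit of the maximum points is the required point. *)

(** * Zeros of trigonometric polynomials near a maximum *)

(** There is a root strictly between any two consecutive sample points, and
    these D + 1 roots are distinct. *)
Lemma size_gt_sign_changes (R : realType) (D : nat) (p : {poly R}) (u : nat -> R) :
  (forall i, (i <= D)%N -> u i < u i.+1) ->
  (forall i, (i <= D.+1)%N -> 0 < (-1) ^+ i * p.[u i]) ->
  (D.+1 < size p)%N.
Proof.
move=> u_incr alt.
have root_in i : (i <= D)%N -> exists x, [/\ u i < x, x < u i.+1 & root p x].
  move=> iD.
  have alt0 := alt i (leqW iD); have alt1 := alt i.+1 iD.
  have uu := u_incr i iD.
  have [x xin rx] : exists2 x, u i <= x <= u i.+1 & root ((-1) ^+ i.+1 *: p) x.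
    apply: poly_ivt; first exact: ltW.
    rewrite !hornerZ (ltW alt1) andbT.
    by move: alt0; rewrite exprS mulN1r mulNr oppr_le0; apply: ltW.
  exists x.
  have rpx : root p x by rewrite rootZ // signr_eq0 in rx.
  case/andP: xin => x1 x2.
  split=> //; rewrite lt_neqAle ?x1 ?x2 andbT; apply/eqP => E.
  - by move: alt0; rewrite E (rootP rpx) mulr0 ltxx.
  - by move: alt1; rewrite -E (rootP rpx) mulr0 ltxx.
have [z zP] : {z : nat -> R & forall i, (i <= D)%N ->
    [/\ u i < z i, z i < u i.+1 & root p (z i)]}.
  apply: (@boolp.choice _ _ (fun i x => (i <= D)%N ->
    [/\ u i < x, x < u i.+1 & root p x])) => i.
  case: (leqP i D) => [/root_in [x xP]|lt]; first by exists x.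
  by exists 0.
have z_incr i j : (j <= D)%N -> (i < j)%N -> z i < z j.
  elim: j => // j IH jD; rewrite ltnS leq_eqVlt => ij.
  have step : z j < z j.+1.
    case: (zP j (ltnW jD)) => _ h _; case: (zP _ jD) => h' _ _.
    exact: lt_trans h h'.
  case/orP: ij => [/eqP ->|ij] //.
  exact: lt_trans (IH (ltnW jD) ij) step.
have p_neq0 : p != 0.
  apply/eqP => p0; have := alt 0%N isT.
  by rewrite p0 horner0 mulr0 ltxx.
suff : (size [seq z i | i <- iota 0 D.+1] < size p)%N by rewrite size_map size_iota.
apply: max_poly_roots => //.
  apply/allP => x /mapP [i]; rewrite mem_iota add0n ltnS => iD ->.
  by case: (zP i iD).
rewrite map_inj_in_uniq ?iota_uniq // => i j.
rewrite !mem_iota !add0n !ltnS /= => iD jD E.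
case: (ltngtP i j) => // ij.
- by move: (z_incr i j jD ij); rewrite E ltxx.
- by move: (z_incr j i iD ij); rewrite E ltxx.
Qed.

(** Trigonometric polynomials of degree at most N, in the half-angle chart: on
    the circle minus the point opposite to [a], they are cos t ^ (2 N) times a
    polynomial of degree at most 2 N in tan t.  Asking for this around every
    [a] makes the class invariant under rotations and lets the missing point
    of the chart be placed anywhere. *)
Definition trigpoly (R : realType) (N : nat) (f : R -> R) : Prop :=
  forall a : R, exists2 p : {poly R}, (size p <= N.*2.+1)%N &
    forall t : R, cos t != 0 -> f (a + t *+ 2) = cos t ^+ N.*2 * p.[tan t].

Section TrigPoly.
Variable R : realType.
Implicit Types (f g : R -> R) (N : nat).

Lemma eq_trigpoly N f g : f =1 g -> trigpoly N f -> trigpoly N g.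
Proof.
by move=> fg tf a; case: (tf a) => p sp fE; exists p => // t ct; rewrite -fg fE.
Qed.

Lemma trigpoly_cst N (c : R) : trigpoly N (fun=> c).
Proof.
move=> a; exists (c *: (1 + 'X^2) ^+ N).
  rewrite (leq_trans (size_scale_leq _ _)) //.
  rewrite (leq_trans (size_poly_exp_leq _ _)) // -mul2n ltnS leq_mul2r.
  apply/orP; right; rewrite -subn1 leq_subLR.
  by rewrite (leq_trans (size_polyD _ _)) // size_polyXn size_poly1.
move=> t ct; rewrite hornerZ horner_exp hornerD hornerXn -polyC1 hornerC.
rewrite -cos2_tan2 // -mul2n exprM exprVn mulrCA divff ?mulr1 //.
by rewrite !expf_neq0.
Qed.

Lemma trigpolyD N f g : trigpoly N f -> trigpoly N g ->
  trigpoly N (fun x => f x + g x).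
Proof.
move=> tf tg a; case: (tf a) (tg a) => p sp fE [q sq gE].
exists (p + q).
  by rewrite (leq_trans (size_polyD _ _)) // geq_max sp sq.
by move=> t ct; rewrite fE // gE // hornerD mulrDr.
Qed.

Lemma trigpolyM M N f g : trigpoly M f -> trigpoly N g ->
  trigpoly (M + N) (fun x => f x * g x).
Proof.
move=> tf tg a; case: (tf a) (tg a) => p sp fE [q sq gE].
exists (p * q).
  by rewrite (leq_trans (size_polyMleq _ _)) // doubleD; lia.
by move=> t ct; rewrite fE // gE // hornerM doubleD exprD; ring.
Qed.

Lemma trigpolyZ N (c : R) f : trigpoly N f -> trigpoly N (fun x => c * f x).
Proof. exact: (trigpolyM (trigpoly_cst 0 c)). Qed.

Lemma trigpoly_cos_sin (u v : R) : trigpoly 1 (fun x => cos x * u + sin x * v).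
Proof.
move=> a.
exists (((cos a * u + sin a * v)%:P * (1 - 'X^2)
        + ((cos a * v - sin a * u) *+ 2)%:P * 'X)).
  apply: (leq_trans (size_polyD _ _)); rewrite geq_max; apply/andP; split.
    rewrite mul_polyC (leq_trans (size_scale_leq _ _)) //.
    rewrite (leq_trans (size_polyD _ _)) // size_polyN size_polyXn size_poly1.
    by [].
  rewrite mul_polyC (leq_trans (size_scale_leq _ _)) // size_polyX //.
move=> t ct.
have st : sin t = tan t * cos t by rewrite /tan mulfVK.
have ct2 : cos t ^+ 2 * (1 + tan t ^+ 2) = 1.
  by rewrite -cos2_tan2 // divff // expf_eq0.
have ctE : cos (t *+ 2) = cos t ^+ 2 * (1 - tan t ^+ 2).
  by rewrite cos_mulr2n -[X in _ - X]ct2; ring.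
have stE : sin (t *+ 2) = cos t ^+ 2 * (tan t *+ 2).
  by rewrite sin_mulr2n st; ring.
rewrite hornerD !hornerM !hornerC hornerD hornerN hornerXn hornerX -polyC1 hornerC.
by rewrite cosD sinD ctE stE /=; ring.
Qed.

Lemma trigpoly_cosM_sinM N :
  trigpoly N (fun x : R => cos (x *+ N)) /\ trigpoly N (fun x : R => sin (x *+ N)).
Proof.
elim: N => [|N [tc ts]].
  split; [apply: eq_trigpoly (trigpoly_cst 0 1)|apply: eq_trigpoly (trigpoly_cst 0 0)].
    by move=> x; rewrite mulr0n cos0.
  by move=> x; rewrite mulr0n sin0.
have c1 := trigpoly_cos_sin 1 0; have s1 := trigpoly_cos_sin 0 1.
have nm f : trigpoly N.+1 f -> trigpoly N.+1 (fun x => (-1) * f x).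
  exact: trigpolyZ.
split.
  apply: eq_trigpoly (trigpolyD (trigpolyM c1 tc) (nm _ (trigpolyM s1 ts))) => x.
  by rewrite mulrS cosD; ring.
apply: eq_trigpoly (trigpolyD (trigpolyM s1 tc) (trigpolyM c1 ts)) => x.
by rewrite mulrS sinD; ring.
Qed.


Lemma trigpoly_leq M N f : (M <= N)%N -> trigpoly M f -> trigpoly N f.
Proof.
move=> MN tf; rewrite -(subnK MN).
by apply: eq_trigpoly (trigpolyM (trigpoly_cst (N - M) 1) tf) => x; rewrite mul1r.
Qed.

Lemma trigpoly_prod (I : finType) (D : I -> nat) (f : I -> R -> R) :
  (forall i, trigpoly (D i) (f i)) ->
  trigpoly (\sum_i D i) (fun x => \prod_i f i x).
Proof.
move=> tf; rewrite /index_enum; elim: (Finite.enum _) => [|i r IH].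
  by rewrite big_nil; apply: eq_trigpoly (trigpoly_cst 0 1) => x; rewrite big_nil.
rewrite big_cons; apply: eq_trigpoly (trigpolyM (tf i) IH) => x.
by rewrite big_cons.
Qed.

Lemma trigpolyX N k f : trigpoly N f -> trigpoly (k * N) (fun x => f x ^+ k).
Proof.
move=> tf; elim: k => [|k IH]; first exact: trigpoly_cst.
by rewrite mulSn; apply: eq_trigpoly (trigpolyM tf IH) => x; rewrite exprS.
Qed.

Lemma trigpoly_sum (I : Type) (r : seq I) (P : pred I) N (f : I -> R -> R) :
  (forall i, P i -> trigpoly N (f i)) ->
  trigpoly N (fun x => \sum_(i <- r | P i) f i x).
Proof.
move=> tf; elim: r => [|i r IH].
  by apply: eq_trigpoly (trigpoly_cst N 0) => x; rewrite big_nil.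
case Pi : (P i).
  by apply: eq_trigpoly (trigpolyD (tf i Pi) IH) => x; rewrite big_cons Pi.
by apply: eq_trigpoly IH => x; rewrite big_cons Pi.
Qed.

(** The samples lie in an open arc of length 2 pi, on which the chart centred
    at [a] turns [g] into a polynomial of degree at most 2 N, with the same
    sign changes because tan is increasing. *)
Lemma trigpoly_sign_changes N g (a : R) (u : nat -> R) :
  trigpoly N g ->
  (forall i, (i <= N.*2)%N -> u i < u i.+1) ->
  a - pi < u 0%N -> u N.*2.+1 < a + pi ->
  ~ (forall i, (i <= N.*2.+1)%N -> 0 < (-1) ^+ i * g (u i)).
Proof.
move=> tg u_incr u0 uN alt; case: (tg a) => p sp gE.
have u_mono i j : (j <= N.*2.+1)%N -> (i <= j)%N -> u i <= u j.
  elim: j => [|j IH] jN; first by rewrite leqn0 => /eqP ->.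
  rewrite leq_eqVlt => /orP [/eqP -> //|ij].
  exact: le_trans (IH (ltnW jN) ij) (ltW (u_incr j jN)).
pose t i := (u i - a) / 2.
have tE i : u i = a + t i *+ 2 by rewrite -mulr_natr /t; field.
have t_in i : (i <= N.*2.+1)%N -> - (pi / 2) < t i < pi / 2.
  move=> iN; have := u_mono _ _ iN (leq0n i).
  have := u_mono _ _ (leqnn _) iN; rewrite /t => h1 h2.
  by apply/andP; split; lra.
have cos_t i : (i <= N.*2.+1)%N -> 0 < cos (t i).
  by move=> iN; apply: cos_gt0_pihalf; apply: t_in.
suff : (N.*2.+1 < size p)%N by rewrite ltnNge sp.
apply: (@size_gt_sign_changes _ _ _ (fun i => tan (t i))) => i iN.
  have ti := t_in i (leqW iN); have tSi := t_in i.+1 iN.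
  by rewrite ltr_tan ?in_itv //= /t; have := u_incr i iN; lra.
have ci := cos_t i iN.
have := alt i iN; rewrite tE gE ?gt_eqF // mulrCA pmulr_rgt0 //.
exact: exprn_gt0.
Qed.

End TrigPoly.

(** M. Riesz's theorem.  If a zero [al] were closer to the maximum point 0
    than a quarter period pi / (2 N) of cos (N x), compare f with the wave
    M cos (N (x + e)), where e > 0 is small and M is slightly larger than the
    maximum of |f|.  The difference has the sign of the wave at its crests and
    troughs; on the first descent of the wave it also dips below zero at 0 and
    returns above zero at [al].  Those two extra sign changes are more than
    the degree allows. *)
Lemma trigpoly_max_zero (R : realType) N (f : R -> R) (al : R) :
  (0 < N)%N -> trigpoly N f -> (forall x, `|f x| <= f 0) -> 0 < f 0 ->
  0 < al -> f al = 0 -> pi / (2 * N%:R) <= al.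
Proof.
move=> N0 tf fmax f0 al0 fal; rewrite leNgt; apply/negP => al_lt.
have NR0 : 0 < N%:R :> R by rewrite ltr0n.
have pi0 := @pi_gt0 R.
pose w : R := pi / N%:R.
have w0 : 0 < w by exact: divr_gt0.
have wE : pi / (2 * N%:R) = w / 2 :> R by rewrite /w; field; rewrite gt_eqF.
have wN : w * N%:R = pi by rewrite /w mulfVK // gt_eqF.
clearbody w.
rewrite wE in al_lt.
(* With this shift the crest - e lies left of 0, and al is still before the
   first zero of the wave. *)
have [e eE] : exists e, e = (w / 2 - al) / 2 by exists ((w / 2 - al) / 2).
have e0 : 0 < e by lra.
have ew : e < w / 2 by lra.
have pi2 : w / 2 * N%:R = pi / 2 by rewrite -wN; field.
have cose : 0 < cos (e *+ N) < 1.
  rewrite -mulr_natr; apply/andP; split.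
    apply: cos_gt0_pihalf; rewrite -pi2 -mulNr !ltr_pM2r //.
    by apply/andP; split; lra.
  rewrite -[X in _ < X]cos0 ltr_cos ?in_itv /= ?lexx ?(ltW pi0) //.
    by rewrite mulr_gt0.
  by rewrite mulr_ge0 ?ltW //= -wN ltr_pM2r //; lra.
have cosal : 0 < cos ((al + e) *+ N).
  rewrite -mulr_natr; apply: cos_gt0_pihalf.
  by rewrite -pi2 -mulNr !ltr_pM2r //; apply/andP; split; lra.
case/andP: cose => c0 c1.
have [c cE] : exists c, c = cos (e *+ N) by exists (cos (e *+ N)).
rewrite -cE in c0 c1.
(* The midpoint of f 0 and f 0 / c: the wave exceeds |f| at its crests but is
   below f at 0. *)
pose M := f 0 * (1 + c^-1) / 2.
have Mc : M * c < f 0.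
  rewrite /M; have -> : f 0 * (1 + c^-1) / 2 * c = f 0 * ((1 + c) / 2).
    by field; rewrite gt_eqF.
  by rewrite gtr_pMr //; lra.
have M0 : f 0 < M.
  rewrite /M -mulrA ltr_pMr //.
  have : 1 < c^-1 by rewrite invf_gt1.
  lra.
clearbody M.
pose g x := M * cos ((x + e) *+ N) - f x.
have tg : trigpoly N g.
  have [tc ts] := trigpoly_cosM_sinM R N.
  have := trigpolyD (trigpolyD (trigpolyZ (M * cos (e *+ N)) tc)
     (trigpolyZ (- (M * sin (e *+ N))) ts)) (trigpolyZ (-1) tf).
  by apply: eq_trigpoly => x; rewrite /g mulrnDl cosD; ring.
(* The crest - e, the points 0 and al, then the following troughs and crests;
   the chart is centred so that all of them fit in one turn. *)
pose u i : R := match i with 0%N => - e | 1%N => 0 | 2%N => al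
  | k.+3 => w *+ k.+1 - e end.
have uE k : u k.+2.+1 = w *+ k.+1 - e by [].
apply: (@trigpoly_sign_changes R N g (pi - e - w / 2) u tg).
- case=> [|[|[|k]]] _; rewrite /u ?oppr_lt0 //.
    by rewrite mulr1n; lra.
  by rewrite [in ltRHS]mulrSr; lra.
- by rewrite /u; lra.
- have -> : u N.*2.+1 = w * (N%:R * 2 - 1) - e.
    case: (N) N0 => // n _; rewrite doubleS uE -(mulr_natr w) -muln2; ring.
  by rewrite mulrBr mulrA wN; lra.
case=> [|[|[|k]]] kN.
- rewrite expr0 mul1r /g /u addNr mul0rn cos0 mulr1.
  by have := le_trans (ler_norm _) (fmax (- e)); lra.
- by rewrite expr1 mulN1r /g /u add0r -cE; lra.
- by rewrite sqrrN expr1n mul1r /g /u fal subr0 mulr_gt0 // (lt_trans f0).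
rewrite /g uE subrK -mulrnA mulnC mulrnA -[w *+ N]mulr_natr wN.
have -> : cos (pi *+ k.+1) = (-1) ^+ k.+1 :> R.
  by rewrite -[pi *+ k.+1]add0r (alternatingn (@cosDpi R)) cos0 mulr1.
have := fmax (w *+ k.+1 - e); rewrite ler_norml => /andP [fge fle].
rewrite -[(-1) ^+ k.+3]signr_odd -[(-1) ^+ k.+1]signr_odd /=.
by case: (odd k); rewrite ?expr0 ?expr1; lra.
Qed.

(** * Great circles *)

Section Euclidean.
Variables (R : realType) (d : nat).
Implicit Types (x y z u v : 'rV[R]_d) (P : {mpoly R[d]}).

Definition dot x y : R := \sum_(i < d) x 0 i * y 0 i.

Lemma dotC x y : dot x y = dot y x.
Proof. by apply: eq_bigr => i _; rewrite mulrC. Qed.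

Lemma dotDl x y z : dot (x + y) z = dot x z + dot y z.
Proof. by rewrite -big_split; apply: eq_bigr => i _; rewrite mxE mulrDl. Qed.

Lemma dotZl a x z : dot (a *: x) z = a * dot x z.
Proof. by rewrite mulr_sumr; apply: eq_bigr => i _; rewrite mxE mulrA. Qed.

Lemma dotNl x z : dot (- x) z = - dot x z.
Proof. by rewrite -scaleN1r dotZl mulN1r. Qed.

Lemma dotDr x y z : dot x (y + z) = dot x y + dot x z.
Proof. by rewrite !(dotC x) dotDl. Qed.

Lemma dotZr a x z : dot x (a *: z) = a * dot x z.
Proof. by rewrite !(dotC x) dotZl. Qed.

Lemma dotNr x z : dot x (- z) = - dot x z.
Proof. by rewrite !(dotC x) dotNl. Qed.

Lemma dot_ge0 x : 0 <= dot x x.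
Proof. by apply: sumr_ge0 => i _; rewrite -expr2 sqr_ge0. Qed.

Lemma dot_eq0 x : dot x x = 0 -> x = 0.
Proof.
move=> /eqP; rewrite psumr_eq0 => [/allP h|i _]; last by rewrite -expr2 sqr_ge0.
apply/rowP => i; rewrite mxE; apply/eqP.
by have := h i; rewrite mem_index_enum mulf_eq0 orbb => /(_ isT).
Qed.

Lemma sqr_enorm x : enorm x ^+ 2 = dot x x.
Proof.
rewrite /enorm sqr_sqrtr; last by apply: sumr_ge0 => i _; exact: sqr_ge0.
by apply: eq_bigr => i _; rewrite expr2.
Qed.

Lemma enorm_ge0 x : 0 <= enorm x.
Proof. exact: sqrtr_ge0. Qed.

Lemma le_enorm_dot x (r : R) : 0 <= r -> (enorm x <= r) = (dot x x <= r ^+ 2).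
Proof. by move=> r0; rewrite -sqr_enorm ler_sqr ?nnegrE // enorm_ge0. Qed.

Lemma trigpoly_arc u v i :
  trigpoly 1 (fun t : R => (cos t *: u + sin t *: v) 0 i).
Proof. by apply: eq_trigpoly (trigpoly_cos_sin (u 0 i) (v 0 i)) => t; rewrite !mxE. Qed.

Lemma trigpoly_dot_arc u v :
  trigpoly 2 (fun t : R => dot (cos t *: u + sin t *: v) (cos t *: u + sin t *: v)).
Proof.
apply: (@trigpoly_sum _ _ _ _ _ (fun i t => _ * _)) => i _.
exact: (trigpolyM (trigpoly_arc u v i) (trigpoly_arc u v i)).
Qed.

(** Each monomial of P has degree at most n, and the coordinates of a point
    moving on a great circle are trigonometric polynomials of degree 1. *)
Lemma trigpoly_peval_arc P n u v : (msize P <= n.+1)%N ->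
  trigpoly n (fun t : R => peval P (cos t *: u + sin t *: v)).
Proof.
move=> sP.
pose f (m : 'X_{1..d}) (t : R) := P@_m * \prod_i (cos t *: u + sin t *: v) 0 i ^+ m i.
apply: (@eq_trigpoly _ _ (fun t => \sum_(m <- msupp P | m \in msupp P) f m t)).
  by move=> t; rewrite /peval mevalE -big_seq.
apply: trigpoly_sum => m mP; apply: trigpolyZ.
have mn : (mdeg m <= n)%N by rewrite -ltnS (leq_trans (msize_mdeg_lt mP)).
apply: (trigpoly_leq mn); rewrite mdegE.
apply: (@trigpoly_prod _ _ _ (fun i t => (cos t *: u + sin t *: v) 0 i ^+ m i)) => i.
by rewrite -[X in trigpoly X]muln1; apply: trigpolyX; apply: trigpoly_arc.
Qed.

(** The points (x, y) and (z, w) of the sphere of radius r in R^(d+1) lie on a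
    common great circle, and F is read off the first d coordinates.  If the
    angle between the two points were less than pi / (2 N), Riesz's theorem on
    that circle would be violated. *)
Lemma sphere_max_zero (F : 'rV[R]_d -> R) N (r y w : R) x z :
  (0 < N)%N -> 0 < r ->
  (forall u v, trigpoly N (fun t => F (cos t *: u + sin t *: v))) ->
  (forall u, dot u u <= r ^+ 2 -> `|F u| <= `|F x|) ->
  F x != 0 -> F z = 0 ->
  dot x x + y ^+ 2 = r ^+ 2 -> dot z z + w ^+ 2 = r ^+ 2 ->
  dot x z + y * w <= r ^+ 2 * cos (pi / (2 * N%:R)).
Proof.
move=> N0 r0 tF Fmax Fx Fz xr zr; rewrite leNgt; apply/negP => lt.
have r20 : 0 < r ^+ 2 by rewrite exprn_gt0.
have NR0 : 1 <= N%:R :> R by rewrite ler1n.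
have pi0 := @pi_gt0 R.
have dl0 : 0 < pi / (2 * N%:R) :> R by rewrite divr_gt0 // mulr_gt0 //; lra.
have dlpi : pi / (2 * N%:R) <= pi / 2 :> R.
  by rewrite ler_pM2l // lef_pV2 ?posrE //; lra.
have [c cE] : exists c, c = (dot x z + y * w) / r ^+ 2 by eexists.
have crE : dot x z + y * w = c * r ^+ 2 by rewrite cE mulfVK // gt_eqF.
have c_gt : cos (pi / (2 * N%:R)) < c by rewrite cE ltr_pdivlMr // mulrC.
have cos0 : 0 <= cos (pi / (2 * N%:R)) :> R by apply: cos_ge0_pihalf; lra.
(* The squared chord; c is the cosine of the angle between (x, y) and (z, w). *)
have distE : dot (x - z) (x - z) + (y - w) ^+ 2 = 2 * r ^+ 2 * (1 - c).
  rewrite !(dotDl, dotDr, dotNl, dotNr) (dotC z x).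
  have -> : 2 * r ^+ 2 * (1 - c) = r ^+ 2 + r ^+ 2 - 2 * (c * r ^+ 2) by ring.
  by rewrite -crE -{1}xr -zr; ring.
have c_lt : c < 1.
  have := addr_ge0 (dot_ge0 (x - z)) (sqr_ge0 (y - w)).
  rewrite distE pmulr_rge0; last by lra.
  rewrite subr_ge0 le_eqVlt => /orP [/eqP c1|//].
  have : dot (x - z) (x - z) = 0.
    move: distE; rewrite c1 subrr mulr0.
    by have := dot_ge0 (x - z); have := sqr_ge0 (y - w); lra.
  by move/dot_eq0/subr0_eq => xz; move: Fx; rewrite xz Fz eqxx.
have cin : -1 <= c <= 1 by lra.
have [al alE] : exists al, al = acos c by eexists.
have cosal : cos al = c by rewrite alE acosK // in_itv /=; lra.
have al0 : 0 < al by rewrite alE acos_gt0 //; lra.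
have alpi : al <= pi by rewrite alE acos_lepi.
have al_lt : al < pi / (2 * N%:R).
  by rewrite -ltr_cos ?in_itv /= ?cosal //; lra.
have s0 : 0 < sin al by apply: sin_gt0_pi; lra.
have s2 : sin al ^+ 2 = 1 - c ^+ 2 by rewrite sin2cos2 cosal.
(* (v, v') is orthogonal to (x, y), of norm r, and points towards (z, w). *)
pose v := (sin al)^-1 *: (z - c *: x).
pose v' := (sin al)^-1 * (w - c * y).
have xv : dot x v + y * v' = 0.
  rewrite /v /v' dotZr dotDr dotNr dotZr.
  have -> : (sin al)^-1 * (dot x z - c * dot x x) + y * ((sin al)^-1 * (w - c * y))
    = (sin al)^-1 * ((dot x z + y * w) - c * (dot x x + y ^+ 2)) by ring.
  by rewrite crE xr subrr mulr0.
have vv : dot v v + v' ^+ 2 = r ^+ 2.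
  rewrite /v /v' dotZr dotZl !(dotDl, dotDr, dotNl, dotNr, dotZl, dotZr) (dotC z x).
  transitivity ((sin al)^-2 * ((dot z z + w ^+ 2) - 2 * c * (dot x z + y * w)
      + c ^+ 2 * (dot x x + y ^+ 2))); first by field; rewrite gt_eqF.
  rewrite xr zr crE.
  have -> : r ^+ 2 - 2 * c * (c * r ^+ 2) + c ^+ 2 * r ^+ 2 = sin al ^+ 2 * r ^+ 2.
    by rewrite s2; ring.
  by rewrite mulrA mulVf ?mul1r // expf_neq0 // gt_eqF.
have vE : sin al *: v = z - c *: x.
  by rewrite /v scalerA divff ?gt_eqF // scale1r.
clearbody v v'.
pose X t := cos t *: x + sin t *: v.
have X_in t : dot (X t) (X t) <= r ^+ 2.
  have : dot (X t) (X t) + (cos t * y + sin t * v') ^+ 2 = r ^+ 2.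
    rewrite /X !(dotDl, dotDr, dotZl, dotZr) (dotC v x).
    transitivity (cos t ^+ 2 * (dot x x + y ^+ 2) + sin t ^+ 2 * (dot v v + v' ^+ 2)
      + 2 * cos t * sin t * (dot x v + y * v')); first by ring.
    by rewrite xr vv xv mulr0 addr0 -mulrDl cos2Dsin2 mul1r.
  by have := sqr_ge0 (cos t * y + sin t * v'); lra.
have X0 : X 0 = x by rewrite /X trigo.cos0 sin0 scale1r scale0r addr0.
have Xal : X al = z.
  by rewrite /X cosal vE addrC subrK.
(* The factor F x makes the value at 0 positive. *)
have tf : trigpoly N (fun t => F x * F (X t)) by apply: trigpolyZ; apply: tF.
have := @trigpoly_max_zero R N _ al N0 tf.
rewrite /= X0 Xal Fz mulr0 -expr2 => h.
suff : pi / (2 * N%:R) <= al by lra.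
apply: h => //.
  by move=> t; rewrite normrM -[leRHS]ger0_norm ?sqr_ge0 // normrX expr2
    ler_wpM2l // Fmax.
by rewrite lt_def sqrf_eq0 Fx sqr_ge0.
Qed.

End Euclidean.

(** * Limits along an ultrafilter *)

Lemma ultra_cvg_compact (T : topologicalType) (U : set_system nat) (u : nat -> T)
    (K : set T) :
  UltraFilter U -> compact K -> (\forall m \near U, K (u m)) ->
  exists2 l, K l & (u @ U --> l)%classic.
Proof.
move=> UU; rewrite compact_ultra => cK KU.
have uU : UltraFilter (u @ U)%classic.
  split=> [|G GP sub]; first exact: fmap_proper_filter.
  rewrite eqEsubset; split=> // A GA.
  case: (@in_ultra_setVsetC _ _ (u @^-1` A)%classic UU) => // UA.
  have GCA : G (~` A)%classic by apply: sub.
  by have := filter_ex (filterI GA GCA); case=> x [].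
by have [l [Kl ul]] := cK _ uU KU; exists l.
Qed.

(** The Cauchy estimate at radius 2 rho makes the terms decay like 2 ^ - i on
    the disc of radius rho. *)
Lemma horner_tail_bound (R : realType) (p : {poly R}) (rho E t : R) K :
  0 < rho -> `|t| <= rho -> (forall i, `|p`_i| * (2 * rho) ^+ i <= E) ->
  `|p.[t] - \sum_(i < K) p`_i * t ^+ i| <= 2 * E / 2 ^+ K.
Proof.
move=> rho0 t_le pE.
have E0 : 0 <= E.
  by apply: le_trans (pE 0%N); rewrite mulr_ge0 ?normr_ge0 ?exprn_ge0 //; lra.
have term i : `|p`_i * t ^+ i| <= E / 2 ^+ i.
  rewrite ler_pdivlMr ?exprn_gt0 // normrM normrX.
  apply: le_trans (pE i); rewrite -mulrA ler_wpM2l //.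
  by rewrite -exprMn lerXn2r ?nnegrE ?mulr_ge0 ?(ltW rho0) //; lra.
have part n : `|\sum_(i < K + n) p`_i * t ^+ i - \sum_(i < K) p`_i * t ^+ i|
    <= 2 * E / 2 ^+ K - 2 * E / 2 ^+ (K + n).
  elim: n => [|n IH]; first by rewrite addn0 !subrr normr0.
  rewrite addnS big_ord_recr /= addrAC (le_trans (ler_normD _ _)) //.
  apply: le_trans (lerD IH (term _)) _.
  have -> : 2 * E / 2 ^+ (K + n).+1 = E / 2 ^+ (K + n).
    by rewrite exprS; field; rewrite expf_neq0.
  by lra.
have := part (size p); rewrite -(horner_coef_wide _ (leq_addl K (size p))).
move/le_trans; apply; rewrite gerBl.
by rewrite divr_ge0 ?mulr_ge0 ?exprn_ge0.
Qed.

(** A normal families argument.  Coefficients with common Cauchy estimates of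
    every radius converge along U, and the tails are uniformly small, so the
    limit of the values and the sum of the limit series agree up to each
    tail. *)
Lemma ultra_entire_limit (R : realType) (U : set_system nat) (p : nat -> {poly R}) :
  UltraFilter U ->
  (forall rho : R, 0 < rho -> exists E, forall m i, `|(p m)`_i| * rho ^+ i <= E) ->
  exists a : nat -> R, forall (t : nat -> R) (s : R), (t @ U --> s)%classic ->
    exists2 L : R, (pseries a s @ \oo --> L)%classic &
      ((fun m => (p m).[t m]) @ U --> L)%classic.
Proof.
move=> UU pB.
have UP : ProperFilter U by exact: ultra_proper.
have [a aP] : {a : nat -> R & forall i, ((fun m => (p m)`_i) @ U --> a i)%classic}.
  apply: (@boolp.choice _ _ (fun i x => ((fun m => (p m)`_i) @ U --> x)%classic)) => i.
  have [E EP] := pB 1 ltr01.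
  have [||l _ lP] := @ultra_cvg_compact R U (fun m => (p m)`_i) `[(- E), E]%classic UU.
  - exact: segment_compact.
  - by apply: nearW => m; have := EP m i; rewrite expr1n mulr1 /= in_itv /= ler_norml.
  - by exists l.
exists a => t s ts.
pose rho : R := `|s| + 1.
have rho0 : 0 < rho by rewrite ltr_wpDl.
have [E EP] : exists E, forall m i, `|(p m)`_i| * (2 * rho) ^+ i <= E.
  by apply: pB; rewrite mulr_gt0.
have t_le : \forall m \near U, `|t m| <= rho.
  move/cvgrPdist_le: ts => /(_ _ ltr01); apply: filterS => m.
  by rewrite -normrN opprB => h; rewrite -[t m](subrK s) (le_trans (ler_normD _ _)) // addrC lerD2l.
have tail K : \forall m \near U,
    `|(p m).[t m] - \sum_(i < K) (p m)`_i * t m ^+ i| <= 2 * E / 2 ^+ K.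
  by move: t_le; apply: filterS => m tm; apply: (horner_tail_bound K rho0 tm (EP m)).
have [||L _ LP] := @ultra_cvg_compact R U (fun m => (p m).[t m])
    `[(- (2 * E)), (2 * E)]%classic UU.
- exact: segment_compact.
- have := tail 0%N; apply: filterS => m.
  by rewrite big_ord0 subr0 expr0 divr1 /= in_itv /= ler_norml.
exists L => //.
have cX i : ((fun m => t m ^+ i) @ U --> s ^+ i)%classic.
  exact: (continuous_cvg _ (@exprn_continuous R i s) ts).
have partial K : ((fun m => \sum_(i < K) (p m)`_i * t m ^+ i) @ U -->
    \sum_(i < K) a i * s ^+ i)%classic.
  elim: K => [|K IH].
    by rewrite big_ord0; under eq_cvg do rewrite big_ord0; exact: cvg_cst.
  rewrite big_ord_recr /=; under eq_cvg do rewrite big_ord_recr /=.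
  by apply: cvgD IH _; apply: cvgM.
have Ltail K : `|L - \sum_(i < K) a i * s ^+ i| <= 2 * E / 2 ^+ K.
  exact: (cvgr_to_le (cvg_norm (cvgB LP (partial K))) (tail K)).
have geo : (geometric (2 * E) 2^-1 @ \oo --> (0 : R))%classic.
  by apply: cvg_geometric; rewrite ger0_norm ?invf_lt1 ?ltr1n.
apply/cvgrPdist_le => e e0.
move/cvgrPdist_le: geo => /(_ _ e0); apply: filterS => K.
rewrite sub0r normrN /geometric /= exprVn => h.
rewrite /pseries /series /= big_mkord.
by apply: le_trans (Ltail K) _; apply: le_trans (ler_norm _) h.
Qed.

(** * Limits of products of even quadratic factors *)

Section QuadraticProducts.
Variable R : realType.

Definition quad_prod (a : nat -> R) (m : nat) (t : R) : R :=
  \prod_(j < m) (1 - a j * t ^+ 2).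

(** [quad_prod] expanded at [x0]; the coefficientwise limit of these expansions
    is the power series at [x0] of the limit function. *)
Definition quad_poly (a : nat -> R) (x0 : R) (m : nat) : {poly R} :=
  \prod_(j < m) (1 - a j *: ('X + x0%:P) ^+ 2).

Lemma horner_quad_poly a x0 m t : (quad_poly a x0 m).[t] = quad_prod a m (t + x0).
Proof.
rewrite /quad_poly /quad_prod horner_prod; apply: eq_bigr => j _.
by rewrite hornerD hornerN hornerZ horner_exp hornerD hornerX -polyC1 !hornerC.
Qed.

(** The factor 1 - c (X + x0)^2 has its coefficients dominated by those of
    1 + c (X + |x0|)^2, whose value at rho is the constant on the right. *)
Lemma coef_quad_mul_bound (q : {poly R}) (c x0 rho B : R) :
  0 <= c -> 0 < rho -> (forall i, `|q`_i| * rho ^+ i <= B) ->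
  forall i, `|(q * (1 - c *: ('X + x0%:P) ^+ 2))`_i| * rho ^+ i
    <= B * (1 + c * (`|x0| + rho) ^+ 2).
Proof.
move=> c0 rho0 qB i.
have rho_ge0 k : 0 <= rho ^+ k by rewrite exprn_ge0 // ltW.
have B0 : 0 <= B by apply: le_trans (qB 0%N); rewrite mulr_ge0.
have -> : q * (1 - c *: ('X + x0%:P) ^+ 2) =
    (1 - c * x0 ^+ 2) *: q - (c * x0 *+ 2) *: (q * 'X) - c *: (q * 'X^2).
  by rewrite -!mul_polyC !(polyCD, polyCN, polyCM, polyCMn, polyC_exp, polyC1); ring.
rewrite !coefB !coefZ coefMX coefMXn.
set q1 := (if _ then _ else _); set q2 := (if _ then _ else _).
have b1 : `|q1| * rho ^+ i <= B * rho.
  rewrite /q1; case: i {q1 q2} => [|i] /=; first by rewrite normr0 mul0r mulr_ge0 // ltW.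
  by rewrite exprSr mulrA ler_wpM2r ?qB // ltW.
have b2 : `|q2| * rho ^+ i <= B * rho ^+ 2.
  rewrite /q2; case: i {q1 q2 b1} => [|[|i]] /=; rewrite ?normr0 ?mul0r ?mulr_ge0 ?(ltW rho0) //.
  by rewrite !subSS subn0 -addn2 exprD mulrA ler_wpM2r ?qB.
have b0 := qB i.
have n0 : `|1 - c * x0 ^+ 2| <= 1 + c * `|x0| ^+ 2.
  by rewrite (le_trans (ler_normB _ _)) // normr1 normrM normrX (ger0_norm c0).
have tri : `|(1 - c * x0 ^+ 2) * q`_i - (c * x0 *+ 2) * q1 - c * q2| <=
    (1 + c * `|x0| ^+ 2) * `|q`_i| + (c * `|x0| *+ 2) * `|q1| + c * `|q2|.
  apply: (le_trans (ler_normB _ _)); rewrite normrM (ger0_norm c0) lerD2r.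
  apply: (le_trans (ler_normB _ _)); rewrite !normrM; apply: lerD.
    by rewrite ler_wpM2r.
  by rewrite normrMn normrM (ger0_norm c0).
apply: (le_trans (ler_wpM2r (rho_ge0 i) tri)).
have h0 : (1 + c * `|x0| ^+ 2) * (`|q`_i| * rho ^+ i) <= (1 + c * `|x0| ^+ 2) * B.
  by apply: ler_wpM2l => //; rewrite addr_ge0 // mulr_ge0 // exprn_ge0.
have h1 : (c * `|x0| *+ 2) * (`|q1| * rho ^+ i) <= (c * `|x0| *+ 2) * (B * rho).
  by apply: ler_wpM2l => //; rewrite mulrn_wge0 // mulr_ge0.
have h2 : c * (`|q2| * rho ^+ i) <= c * (B * rho ^+ 2) by apply: ler_wpM2l.
have -> : B * (1 + c * (`|x0| + rho) ^+ 2) = (1 + c * `|x0| ^+ 2) * B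
   + (c * `|x0| *+ 2) * (B * rho) + c * (B * rho ^+ 2) by ring.
rewrite 2![in leLHS]mulrDl -!(mulrA _ _ (rho ^+ i)).
exact: lerD (lerD h0 h1) h2.
Qed.

Lemma coef_quad_poly_bound (a : nat -> R) x0 m rho :
  (forall j, 0 <= a j) -> 0 < rho -> forall i,
  `|(quad_poly a x0 m)`_i| * rho ^+ i <=
    expR ((\sum_(j < m) a j) * (`|x0| + rho) ^+ 2).
Proof.
move=> a0 rho0; elim: m => [|m IH] i.
  rewrite /quad_poly !big_ord0 mul0r expR0 coef1.
  by case: i => [|i]; rewrite /= ?normr1 ?normr0 ?mul0r ?ler01 // mul1r expr0.
rewrite /quad_poly !big_ord_recr /= mulrDl expRD.
apply: le_trans (coef_quad_mul_bound x0 (a0 m) rho0 IH i) _.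
by rewrite ler_wpM2l ?expR_ge0 // expR_ge1Dx.
Qed.

(** The Cauchy estimates at every centre depend only on the bound [C] for the
    sums, since a product of factors 1 + a is at most the exponential of the
    sum. *)
Lemma ultra_quad_prod_limit (U : set_system nat) (a : nat -> nat -> R) (C : R) :
  UltraFilter U -> (forall m j, 0 <= a m j) ->
  (forall m, \sum_(j < m) a m j <= C) ->
  exists G : R -> R, [/\ even_function G, real_analytic G &
    forall (t : nat -> R) (s : R), (t @ U --> s)%classic ->
      ((fun m => quad_prod (a m) m (t m)) @ U --> G s)%classic].
Proof.
move=> UU a0 aC.
have UP : ProperFilter U by exact: ultra_proper.
pose G (s : R) : R := lim ((fun m => quad_prod (a m) m s) @ U)%classic.
have expansion x0 : exists b : nat -> R, forall (t : nat -> R) (s : R),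
    (t @ U --> s)%classic -> (pseries b (s - x0) @ \oo --> G s)%classic /\
    ((fun m => quad_prod (a m) m (t m)) @ U --> G s)%classic.
  have [|b bP] := @ultra_entire_limit R U (fun m => quad_poly (a m) x0 m) UU.
    move=> rho rho0; exists (expR (C * (`|x0| + rho) ^+ 2)) => m i.
    apply: le_trans (coef_quad_poly_bound x0 m (a0 m) rho0 i) _.
    by rewrite ler_expR ler_wpM2r // exprn_ge0 // addr_ge0 // ltW.
  exists b => t s ts.
  have shifted (t' : nat -> R) : (t' @ U --> s)%classic ->
      ((fun m => t' m - x0) @ U --> s - x0)%classic.
    by move=> t's; apply: cvgB => //; exact: cvg_cst.
  have back (t' : nat -> R) : (fun m => (quad_poly (a m) x0 m).[t' m - x0]) =
      (fun m => quad_prod (a m) m (t' m)).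
    by apply/funext => m; rewrite horner_quad_poly subrK.
  have [L bL tL] := bP _ _ (shifted t ts).
  have [L' bL' sL'] := bP _ _ (shifted (fun=> s) (cvg_cst _)).
  have LL' : L' = L by exact: (cvg_unique _ bL' bL).
  rewrite back in tL; rewrite (back (fun=> s)) LL' in sL'.
  have -> : G s = L by apply: cvg_lim.
  by [].
exists G; split.
- move=> x; rewrite /G; congr (lim (_ @ U)%classic); apply/funext => m.
  by rewrite /quad_prod sqrrN.
- move=> x0; have [b bP] := expansion x0; exists b, 1; split=> // x _.
  exact: (bP (fun=> x) x (cvg_cst _)).1.
- by move=> t s ts; have [b bP] := expansion 0; exact: (bP t s ts).2.
Qed.

End QuadraticProducts.

(** * Nonvanishing and continuity of polynomials on Euclidean balls *)

Section Nonvanishing.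
Variable R : realType.

Lemma digits_inj (B : nat) k (f g : 'I_k -> nat) :
  (forall i, f i < B)%N -> (forall i, g i < B)%N ->
  (\sum_i f i * B ^ i = \sum_i g i * B ^ i)%N -> f =1 g.
Proof.
elim: k f g => [|k IH] f g fB gB E i; first by case: i.
have split_sum (h : 'I_k.+1 -> nat) :
    (\sum_i h i * B ^ i = (\sum_(i < k) h (lift ord0 i) * B ^ i) * B + h ord0)%N.
  rewrite big_ord_recl expn0 muln1 addnC big_distrl /=; congr addn.
  by apply: eq_bigr => j _; rewrite /bump /= add1n expnSr mulnA.
have B0 : (0 < B)%N := leq_ltn_trans (leq0n _) (fB ord0).
rewrite !split_sum in E.
have E0 : f ord0 = g ord0.
  by move: (congr1 (fun x => x %% B)%N E); rewrite /= !modnMDl !modn_small.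
have E1 : (\sum_(i < k) f (lift ord0 i) * B ^ i =
    \sum_(i < k) g (lift ord0 i) * B ^ i)%N.
  by apply/eqP; rewrite -(eqn_pmul2r B0); apply/eqP; move: E; rewrite E0; apply: addIn.
case: (unliftP ord0 i) => [j|] ->; last exact: E0.
exact: (IH (fun j => f (lift ord0 j)) (fun j => g (lift ord0 j))).
Qed.

(** Kronecker's substitution: when B exceeds all exponents, distinct monomials
    become distinct powers of t.  For small t the point is also close to 0. *)
Definition kronecker_point d (B : nat) (t : R) : 'rV[R]_d := \row_i t ^+ (B ^ i).

Lemma mpoly_kronecker d (P : {mpoly R[d]}) : P != 0 ->
  exists2 q : {poly R}, q != 0 &
    forall t, peval P (kronecker_point d (msize P) t) = q.[t].
Proof.
move=> P0; set B := msize P.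
pose code (m : 'X_{1..d}) := (\sum_i m i * B ^ i)%N.
pose q : {poly R} := \sum_(m <- msupp P) P@_m *: 'X^(code m).
exists q; last first.
  move=> t; rewrite /peval mevalE horner_sum; apply: eq_bigr => m _.
  rewrite hornerZ hornerXn; congr (_ * _).
  rewrite (big_morph (fun n => t ^+ n) (exprD t) (expr0 t)); apply: eq_bigr => i _.
  by rewrite mxE -exprM mulnC.
have digit m i : m \in msupp P -> (m i < B)%N.
  move=> mP; apply: leq_ltn_trans (msize_mdeg_lt mP).
  by rewrite mdegE (bigD1 i) //= leq_addr.
have [m0 m0P] : exists m, m \in msupp P.
  have := P0; rewrite -msupp_eq0; case: (msupp P) => // m s _.
  by exists m; rewrite inE eqxx.
apply/eqP => q0; have : q`_(code m0) = P@_m0.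
  rewrite coef_sum (bigD1_seq m0) ?msupp_uniq //= coefZ coefXn eqxx mulr1.
  rewrite big_seq_cond big1 ?addr0 // => m /andP [mP mm0].
  rewrite coefZ coefXn; case: eqP => [E|_]; last by rewrite mulr0.
  case/negP: mm0; apply/eqP/mnmP => i.
  by apply: (@digits_inj B _ (fun i => m i) (fun i => m0 i)) => // j; apply: digit.
by move/eqP; rewrite q0 coef0 eq_sym mcoeff_eq0 m0P.
Qed.

Lemma poly_nonroot_small (q : {poly R}) (e : R) : q != 0 -> 0 < e ->
  exists2 t, 0 < t < e & q.[t] != 0.
Proof.
move=> q0 e0.
pose s := [seq e / (i.+2)%:R | i <- iota 0 (size q)].
have : ~~ all (root q) s.
  apply/negP => sr; have := max_poly_roots q0 sr.
  rewrite size_map size_iota ltnn => h; apply: notF; apply: h.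
  rewrite map_inj_uniq ?iota_uniq // => i j /(mulfI (lt0r_neq0 e0)) /invr_inj /eqP.
  by rewrite eqr_nat => /eqP [].
case/allPn => x /mapP [i _ ->] nr; exists (e / i.+2%:R) => //.
rewrite divr_gt0 //=.
by rewrite ltr_pdivrMr ?ltr0n // ltr_pMr // ltr1n.
Qed.

Lemma peval_nonzero_small d (P : {mpoly R[d]}) (e : R) : P != 0 -> 0 < e ->
  exists2 x, enorm x < e & peval P x != 0.
Proof.
move=> P0 e0; have [q q0 qE] := mpoly_kronecker P0.
have D0 : 0 < d.+1%:R :> R by rewrite ltr0n.
have [|t /andP [t0 te] qt] := @poly_nonroot_small q (Num.min 1 (e / d.+1%:R)) q0.
  by rewrite lt_min ltr01 divr_gt0.
move: te; rewrite lt_min => /andP [t1 te].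
exists (kronecker_point d (msize P) t); last by rewrite qE.
have e_ge0 := ltW e0; have t_ge0 := ltW t0.
have dt : d.+1%:R * t < e by rewrite mulrC -ltr_pdivlMr.
rewrite -ltr_sqr ?nnegrE ?enorm_ge0 // sqr_enorm.
have B0 : (0 < msize P)%N by rewrite lt0n msize_poly_eq0.
have : dot (kronecker_point d (msize P) t) (kronecker_point d (msize P) t)
    <= \sum_(i < d) t ^+ 2.
  apply: ler_sum => i _; rewrite mxE -expr2 lerXn2r ?nnegrE ?exprn_ge0 //.
  by rewrite -[leRHS]expr1 ler_wiXn2l ?expn_gt0 ?B0 // ltW.
rewrite sumr_const card_ord -mulr_natl => h; apply: le_lt_trans h _.
apply: le_lt_trans (_ : (d.+1%:R * t) ^+ 2 < _); last first.
  by rewrite ltr_sqr ?nnegrE // mulr_ge0.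
rewrite exprMn ler_wpM2r ?exprn_ge0 // -natrX ler_nat.
by rewrite -[d]expn1 (leq_trans (leqnSn _)) // expn1 -[leqLHS]expn1 leq_pexp2l.
Qed.

End Nonvanishing.

Section Continuity.
Variables (R : realType) (d : nat).

Lemma cvg_dot (T : Type) (F : set_system T) (FF : Filter F)
    (x y : T -> 'rV[R]_d) (a b : 'rV[R]_d) :
  (x @ F --> a)%classic -> (y @ F --> b)%classic ->
  ((fun t => dot (x t) (y t)) @ F --> dot a b)%classic.
Proof.
move=> xa yb; apply: cvg_big => [|i _]; first exact: add_continuous.
by apply: cvgM; [apply: (continuous_cvg _ (@coord_continuous R _ _ 0 i a) xa)|
  apply: (continuous_cvg _ (@coord_continuous R _ _ 0 i b) yb)].
Qed.

Lemma cvg_enorm (T : Type) (F : set_system T) (FF : Filter F)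
    (x : T -> 'rV[R]_d) (a : 'rV[R]_d) :
  (x @ F --> a)%classic -> ((fun t => enorm (x t)) @ F --> enorm a)%classic.
Proof.
move=> xa.
have E u : enorm u = Num.sqrt (dot u u) :> R.
  by rewrite /enorm /dot; under eq_bigr do rewrite expr2.
rewrite E; under eq_cvg do rewrite E.
exact: (continuous_cvg _ (@sqrt_continuous R _) (cvg_dot FF xa xa)).
Qed.

Lemma cvg_peval (T : Type) (F : set_system T) (FF : Filter F) (P : {mpoly R[d]})
    (x : T -> 'rV[R]_d) (a : 'rV[R]_d) :
  (x @ F --> a)%classic -> ((fun t => peval P (x t)) @ F --> peval P a)%classic.
Proof.
move=> xa; rewrite /peval mevalE; under eq_cvg do rewrite mevalE.
apply: cvg_big => [|m _]; first exact: add_continuous.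
apply: cvgM; first exact: cvg_cst.
apply: cvg_big => [|i _]; first exact: mul_continuous.
have xi : ((fun t => x t 0 i) @ F --> a 0 i)%classic.
  exact: (continuous_cvg _ (@coord_continuous R _ _ 0 i a) xa).
exact: (continuous_cvg _ (@exprn_continuous R (m i) (a 0 i)) xi).
Qed.

Lemma compact_enorm_ball (r : R) : compact [set x : 'rV[R]_d | enorm x <= r]%classic.
Proof.
apply: bounded_closed_compact.
  exists `|r|; split=> // M rM x /= xr.
  have M0 : 0 <= M by apply: le_trans (ltW rM).
  rewrite [leLHS]/Num.norm /= mx_normrE; apply/bigmax_leP; split=> // -[i j] _ /=.
  rewrite (ord1 i); apply: le_trans (ltW rM); apply: le_trans (ler_norm r).
  apply: le_trans xr; rewrite -ler_sqr ?nnegrE ?enorm_ge0 //.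
  rewrite sqr_enorm real_normK ?num_real // /dot (bigD1 j) //= -expr2 lerDl.
  by apply: sumr_ge0 => k _; rewrite -expr2 sqr_ge0.
apply: (closed_comp _ (@closed_le R r)) => x _.
exact: (@cvg_enorm _ (nbhs x) _ id x (fun _ h => h)).
Qed.

End Continuity.

(** * Bands covering the sphere outside a polar cap *)

Section SineBounds.
Variable R : realType.

Lemma sin_mvt (u : R) : 0 < u -> exists2 c : R, 0 < c < u & sin u = u * cos c.
Proof.
move=> u0.
have [|c cin] := @MVT R sin cos 0 u u0 (fun x _ => is_derive_sin x).
  exact/continuous_subspaceT/continuous_sin.
rewrite sin0 !subr0 => E; exists c; first by rewrite in_itv in cin.
by rewrite E mulrC.
Qed.

Lemma sin_le_id (u : R) : 0 <= u -> sin u <= u.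
Proof.
rewrite le_eqVlt => /orP [/eqP <-|u0]; first by rewrite sin0.
have [c _ ->] := sin_mvt u0.
by rewrite ger_pMr // cos_le1.
Qed.

Lemma sin_ge_mul_cos (u : R) : 0 < u <= pi -> u * cos u <= sin u.
Proof.
case/andP=> u0 upi; have [c /andP [c0 cu] ->] := sin_mvt u0.
by rewrite ler_pM2l // ltW // ltr_cos // in_itv /=; lra.
Qed.

(** With v = u / 2: sin u = 2 sin v cos v >= 2 v (cos v)^2, and
    2 (cos v)^2 = 1 + cos u >= 1. *)
Lemma sin_ge_half (u : R) : 0 < u <= pi / 2 -> u / 2 <= sin u.
Proof.
case/andP=> u0 upi.
have [v vE] : exists v, v = u / 2 by eexists.
have uE : u = v *+ 2 by rewrite vE -mulr_natr; field.
have cu : 0 <= cos u by apply: cos_ge0_pihalf; have := @pi_gt0 R; lra.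
have cv : 1 <= cos v ^+ 2 *+ 2.
  by move: cu; rewrite uE cos_mulr2n subr_ge0.
have sv : v * cos v <= sin v by apply: sin_ge_mul_cos; have := @pi_gt0 R; lra.
have cv0 : 0 <= cos v by apply: cos_ge0_pihalf; have := @pi_gt0 R; lra.
rewrite uE sin_mulr2n.
have := ler_wpM2l cv0 sv.
have ->  : v *+ 2 / 2 = v by rewrite -mulr_natr; field.
have : v * 1 <= v * (cos v ^+ 2 *+ 2) by rewrite ler_wpM2l //; lra.
have -> : v * (cos v ^+ 2 *+ 2) = (cos v * (v * cos v)) *+ 2 by ring.
lra.
Qed.

(** Telescoping, from 1 / (j + 1)^2 <= 2 / ((j + 1) (j + 2)). *)
Lemma sum_inv_sqr_le2 k : \sum_(j < k) (j.+1%:R ^+ 2)^-1 <= 2 :> R.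
Proof.
suff : \sum_(j < k) (j.+1%:R ^+ 2)^-1 <= 2 - 2 / k.+1%:R :> R.
  by move/le_trans; apply; rewrite gerBl divr_ge0.
elim: k => [|k IH]; first by rewrite big_ord0 divr1 subrr.
rewrite big_ord_recr /=; apply: le_trans (lerD IH (lexx _)) _.
have k1 : 1 <= k.+1%:R :> R by rewrite ler1n.
have -> : k.+2%:R = k.+1%:R + 1 :> R by rewrite -natr1.
move: (k.+1%:R : R) k1 => x x1.
rewrite -lerBrDl.
have -> : 2 - 2 / (x + 1) - (2 - 2 / x) = 2 / (x * (x + 1)) by field; lra.
rewrite -div1r ler_pdivrMr ?exprn_gt0 //; last by lra.
have -> : 2 / (x * (x + 1)) * x ^+ 2 = 2 * x / (x + 1) by field; lra.
by rewrite ler_pdivlMr; lra.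
Qed.

End SineBounds.

Section Planks.
Variables (R : realType) (n m : nat).

Definition circ_degree : nat := (n + m.*2)%N.
(** The angular separation between a maximum and a zero in degree N. *)
Definition circ_gap : R := pi / (2 * circ_degree%:R).
(** On this sphere an arc of angle [circ_gap] has length 1 / n. *)
Definition sphere_radius : R := (n%:R * circ_gap)^-1.
(** The half-width of a band.  It has to be strictly less than [circ_gap], for
    otherwise a maximum could sit on the common boundary of two bands; the
    deficit is of lower order than 1 / N so that the 2 m half-widths lose an
    angle negligible against the radius 1 / r of the cap. *)
Definition plank_width : R := circ_gap * (1 - (circ_degree%:R ^+ 2)^-1).
(** What the m bands leave uncovered around the pole. *)
Definition cap_angle : R := pi / 2 - m.*2%:R * plank_width.
Definition plank_center (j : nat) : R := cap_angle + (j.*2.+1)%:R * plank_width.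
(** 1 - plank_coef j * |x|^2 vanishes on the parallel at angle plank_center j
    from the pole. *)
Definition plank_coef (j : nat) : R := ((sphere_radius * sin (plank_center j)) ^+ 2)^-1.

Local Notation N := circ_degree.
Local Notation dlt := circ_gap.
Local Notation r := sphere_radius.
Local Notation w := plank_width.

Hypotheses (n0 : (0 < n)%N) (m0 : (0 < m)%N).

Let nR : (1 : R) <= n%:R. Proof. by rewrite ler1n. Qed.
Let mR : (1 : R) <= m%:R. Proof. by rewrite ler1n. Qed.
Let pi0 := @pi_gt0 R.

Lemma circ_degreeE : N%:R = n%:R + 2 * m%:R :> R.
Proof. by rewrite /circ_degree natrD -muln2 natrM mulrC. Qed.

Let NR : (3 : R) <= N%:R. Proof. by rewrite circ_degreeE; move: nR mR; lra. Qed.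

Ltac bounds_lra := move: nR mR NR pi0; lra.

Lemma circ_gap_gt0 : 0 < dlt.
Proof. by rewrite /circ_gap divr_gt0 // mulr_gt0 //; bounds_lra. Qed.

Lemma circ_gapM : N%:R * dlt = pi / 2.
Proof. by rewrite /circ_gap; field; bounds_lra. Qed.

Lemma circ_gap_le_pi : dlt <= pi.
Proof.
have : 1 * dlt <= N%:R * dlt by rewrite ler_wpM2r ?(ltW circ_gap_gt0) //; bounds_lra.
by rewrite circ_gapM; bounds_lra.
Qed.

Lemma sphere_radius_gt0 : 0 < r.
Proof. by rewrite invr_gt0 mulr_gt0 ?circ_gap_gt0 //; bounds_lra. Qed.

Let Ninv : 0 < ((N%:R : R) ^+ 2)^-1 <= 1 / 2.
Proof.
rewrite invr_gt0 exprn_gt0 /=; last by bounds_lra.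
rewrite div1r lef_pV2 ?posrE ?exprn_gt0 //; last by bounds_lra.
have : (3 : R) ^+ 2 <= N%:R ^+ 2 by rewrite lerXn2r ?nnegrE //; bounds_lra.
bounds_lra.
Qed.

Lemma plank_width_lt : w < dlt.
Proof.
rewrite /plank_width gtr_pMr ?circ_gap_gt0 //.
by case/andP: Ninv; bounds_lra.
Qed.

Lemma plank_width_ge : dlt / 2 <= w.
Proof.
rewrite /plank_width ler_pM2l ?circ_gap_gt0 //.
by case/andP: Ninv; bounds_lra.
Qed.

Lemma plank_width_gt0 : 0 < w.
Proof. by apply: lt_le_trans plank_width_ge; rewrite divr_gt0 ?circ_gap_gt0. Qed.

Lemma cap_angleE : cap_angle = dlt * (n%:R + 2 * m%:R / N%:R ^+ 2).
Proof.
rewrite /cap_angle -circ_gapM /plank_width -muln2 natrM circ_degreeE; field.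
by rewrite -circ_degreeE; bounds_lra.
Qed.

Lemma cap_angle_gt0 : 0 < cap_angle.
Proof.
rewrite cap_angleE mulr_gt0 ?circ_gap_gt0 //.
suff : 0 <= 2 * m%:R / N%:R ^+ 2 :> R by bounds_lra.
by rewrite divr_ge0 ?exprn_ge0.
Qed.

(** The cap has radius n * circ_gap, of length 1, plus the total deficit of the
    bands, which is 2 m circ_gap / N^2. *)
Lemma cap_radius_le : r * cap_angle <= 1 + N%:R^-1.
Proof.
rewrite cap_angleE /sphere_radius.
have -> : (n%:R * dlt)^-1 * (dlt * (n%:R + 2 * m%:R / N%:R ^+ 2)) =
    1 + (2 * m%:R) / (n%:R * N%:R) * N%:R^-1.
  by field; rewrite ?gt_eqF ?circ_gap_gt0; bounds_lra.
rewrite lerD2l ler_piMl ?invr_ge0 //.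
rewrite ler_pdivrMr ?mul1r; last by rewrite mulr_gt0; bounds_lra.
have : 1 * N%:R <= n%:R * N%:R :> R by rewrite ler_wpM2r //; bounds_lra.
by rewrite [X in X <= _]mul1r [X in X <= _]circ_degreeE; bounds_lra.
Qed.

Lemma plank_center_in j : (j < m)%N -> 0 < plank_center j < pi / 2.
Proof.
move=> jm; have w0 := plank_width_gt0; have c0 := cap_angle_gt0.
rewrite /plank_center; apply/andP; split.
  by rewrite addr_gt0 // mulr_gt0 ?ltr0n.
rewrite /cap_angle -addrA gtrDl addrC subr_lt0 ltr_pM2r // ltr_nat.
lia.
Qed.

Lemma plank_cover (b : R) : cap_angle <= b <= pi / 2 ->
  exists2 j, (j < m)%N & `|b - plank_center j| <= w.
Proof.
case/andP=> b0 b1; have w0 := plank_width_gt0.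
suff /(_ m.-1) [|j jm h] : forall k, b <= cap_angle + k.*2.+2%:R * w ->
    exists2 j, (j <= k)%N & `|b - plank_center j| <= w.
- by rewrite -doubleS prednK // /cap_angle subrK.
- by exists j => //; rewrite -(prednK m0) ltnS.
elim=> [|k IH] bk.
  rewrite double0 in bk.
  by exists 0%N => //; rewrite /plank_center double0 ler_norml; apply/andP; split; bounds_lra.
have [h|h] := lerP b (cap_angle + k.*2.+2%:R * w).
  by have [j jk hj] := IH h; exists j => //; apply: leqW.
exists k.+1 => //; rewrite /plank_center ler_norml.
move: bk h; rewrite doubleS -(natr1 k.*2.+3) -(natr1 k.*2.+2) => bk h.
by apply/andP; split; bounds_lra.
Qed.

Lemma plank_coef_ge0 j : 0 <= plank_coef j.
Proof. by rewrite invr_ge0 sqr_ge0. Qed.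

(** Since sin u >= u / 2 up to pi / 2, the radius r sin (plank_center j) of the
    parallel is at least (2 j + 1) / (4 n). *)
Lemma plank_coef_le j : (j < m)%N ->
  plank_coef j <= 16 * n%:R ^+ 2 * (j.+1%:R ^+ 2)^-1.
Proof.
move=> jm; have /andP [c0 c1] := plank_center_in jm.
have r0 := sphere_radius_gt0; have d0 := circ_gap_gt0.
have j0 : 0 < j.+1%:R :> R by rewrite ltr0n.
have low : j.+1%:R / (4 * n%:R) <= r * sin (plank_center j).
  apply: le_trans (_ : r * (plank_center j / 2) <= _); last first.
    by rewrite ler_pM2l // sin_ge_half // c0 ltW.
  have pc : j.+1%:R * (dlt / 2) <= plank_center j.
    apply: le_trans (_ : j.*2.+1%:R * w <= _); last by rewrite lerDr ltW // cap_angle_gt0.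
    apply: ler_pM => //; first by rewrite ltW // divr_gt0.
      by rewrite ler_nat ltnS -addnn leq_addr.
    exact: plank_width_ge.
  have -> : j.+1%:R / (4 * n%:R) = r * (j.+1%:R * (dlt / 2) / 2).
    by rewrite /sphere_radius; field; rewrite ?gt_eqF //; bounds_lra.
  by rewrite ler_pM2l // ler_pM2r.
have low0 : 0 < j.+1%:R / (4 * n%:R) :> R by rewrite divr_gt0 // mulr_gt0 //; bounds_lra.
have -> : 16 * n%:R ^+ 2 * (j.+1%:R ^+ 2)^-1 = ((j.+1%:R / (4 * n%:R)) ^+ 2)^-1 :> R.
  by field; rewrite ?gt_eqF //; bounds_lra.
rewrite lef_pV2 ?posrE ?exprn_gt0 //; last exact: lt_le_trans low.
by rewrite lerXn2r ?nnegrE // ltW // (lt_le_trans low0).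
Qed.

End Planks.

Lemma sum_plank_coef_le (R : realType) n m : (0 < n)%N ->
  \sum_(j < m) plank_coef R n m j <= 32 * n%:R ^+ 2.
Proof.
move=> n0; apply: le_trans (_ : \sum_(j < m) 16 * n%:R ^+ 2 * (j.+1%:R ^+ 2)^-1 <= _).
  apply: ler_sum => j _; apply: plank_coef_le => //.
  exact: leq_ltn_trans (ltn_ord j).
rewrite -mulr_sumr.
have -> : 32 * n%:R ^+ 2 = 16 * n%:R ^+ 2 * 2 :> R by ring.
by rewrite ler_wpM2l ?sum_inv_sqr_le2 // mulr_ge0 // exprn_ge0.
Qed.

(** * The maximum on the sphere *)

Section SphereStage.
Variables (R : realType) (d n m : nat) (P : {mpoly R[d]}).
Hypotheses (n0 : (0 < n)%N) (m0 : (0 < m)%N) (P0 : P != 0) (sP : msize P = n.+1).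

Local Notation N := (circ_degree n m).
Local Notation r := (sphere_radius R n m).

Definition damped (u : 'rV[R]_d) : R :=
  peval P u * quad_prod (plank_coef R n m) m (enorm u).

Lemma trigpoly_damped u v : trigpoly N (fun t => damped (cos t *: u + sin t *: v)).
Proof.
apply: trigpolyM; first by apply: trigpoly_peval_arc; rewrite sP.
have -> : m.*2 = (\sum_(j < m) 2)%N by rewrite sum_nat_const card_ord muln2.
apply: (@trigpoly_prod _ _ _ (fun (j : 'I_m) t => 1 - plank_coef R n m j *
  enorm (cos t *: u + sin t *: v) ^+ 2)) => j.
apply: eq_trigpoly (trigpolyD (trigpoly_cst 2 1)
  (trigpolyZ (- plank_coef R n m j) (trigpoly_dot_arc u v))) => t.
by rewrite sqr_enorm mulNr.
Qed.

Lemma damped_max : exists2 x, enorm x <= r &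
  forall u, enorm u <= r -> `|damped u| <= `|damped x|.
Proof.
have r_ge0 := ltW (sphere_radius_gt0 R n0 m0).
have [||x xr xmax] := @compact_EVT_max _ R (fun u => `|damped u|)
    _ _ (@compact_enorm_ball R d r).
- exists 0; rewrite /= le_enorm_dot // /dot big1 ?sqr_ge0 // => i _.
  by rewrite mxE mul0r.
- apply: continuous_subspaceT => u.
  have Pu : (peval P @ nbhs u --> peval P u)%classic.
    exact: (@cvg_peval _ _ _ (nbhs u) _ P id u (fun _ h => h)).
  have eu : ((@enorm R d) @ nbhs u --> enorm u)%classic.
    exact: (@cvg_enorm _ _ _ (nbhs u) _ id u (fun _ h => h)).
  have e2u : ((fun x => enorm x ^+ 2) @ nbhs u --> enorm u ^+ 2)%classic.
    exact: (continuous_cvg _ (@exprn_continuous R 2 (enorm u)) eu).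
  have Qu : ((fun x => quad_prod (plank_coef R n m) m (enorm x)) @ nbhs u -->
      quad_prod (plank_coef R n m) m (enorm u))%classic.
    apply: cvg_big => [|j _]; first exact: mul_continuous.
    by apply: cvgB; [exact: cvg_cst|apply: cvgM e2u; exact: cvg_cst].
  exact: cvg_norm (cvgM Pu Qu).
exists x; first by rewrite inE in xr.
by move=> u ur; apply: xmax; rewrite inE.
Qed.

Lemma damped_nonzero : exists2 u, enorm u <= r & damped u != 0.
Proof.
have nR : 0 < n%:R :> R by rewrite ltr0n.
have e0 : 0 < Num.min r (1 / (8 * n%:R)).
  by rewrite lt_min sphere_radius_gt0 //= divr_gt0 // mulr_gt0.
have [u] := peval_nonzero_small P0 e0; rewrite lt_min => /andP [ur ue] Pu.
exists u; first exact: ltW.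
rewrite mulf_neq0 //; apply/prodf_neq0 => j _.
have c_le := plank_coef_le R n0 m0 (ltn_ord j).
have j1 : (j.+1%:R ^+ 2)^-1 <= 1 :> R.
  by rewrite invf_le1 ?exprn_gt0 ?ltr0n // exprn_ege1 // ler1n.
have c1 : plank_coef R n m j <= 16 * n%:R ^+ 2.
  by apply: (le_trans c_le); rewrite ler_piMr // mulr_ge0 // exprn_ge0.
rewrite gt_eqF // subr_gt0.
apply: le_lt_trans (_ : 16 * n%:R ^+ 2 * (1 / (8 * n%:R)) ^+ 2 < 1).
  apply: ler_pM => //; rewrite ?plank_coef_ge0 ?sqr_ge0 //.
  by rewrite lerXn2r ?nnegrE ?enorm_ge0 ?divr_ge0 ?mulr_ge0 // ltW.
have -> : 16 * n%:R ^+ 2 * (1 / (8 * n%:R)) ^+ 2 = 1 / 4 :> R by field; rewrite gt_eqF.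
lra.
Qed.

(** The last clause bounds the cosine of the angle between the lifts of x and
    z to the northern hemisphere. *)
Definition near_unit_maximizer (x : 'rV[R]_d) : Prop :=
  [/\ enorm x <= 1 + N%:R^-1,
      forall u, enorm u <= r -> `|damped u| <= `|damped x| &
      forall z, peval P z = 0 -> enorm z <= r ->
        dot x z + Num.sqrt (r ^+ 2 - enorm x ^+ 2) * Num.sqrt (r ^+ 2 - enorm z ^+ 2)
          <= r ^+ 2 * cos (circ_gap R n m)].

(** A maximum point x outside the cap lies in some band; moving it along its
    meridian to the centre of the band gives a zero z at an angle at most
    [plank_width], hence less than [circ_gap], which contradicts
    [sphere_max_zero]. *)
Lemma near_unit_maximizer_exists : exists x, near_unit_maximizer x.
Proof.
have r0 := sphere_radius_gt0 R n0 m0; have r_ge0 := ltW r0.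
have [x xr xmax] := damped_max.
have N0 : (0 < N)%N by rewrite addn_gt0 n0.
have Fx : damped x != 0.
  have [u ur] := damped_nonzero; apply: contraNneq => Fx.
  by rewrite -normr_le0 (le_trans (xmax u ur)) // Fx normr0.
have separation z y w : damped z = 0 -> enorm x ^+ 2 + y ^+ 2 = r ^+ 2 ->
    enorm z ^+ 2 + w ^+ 2 = r ^+ 2 -> dot x z + y * w <= r ^+ 2 * cos (circ_gap R n m).
  rewrite !sqr_enorm => Fz xy zw.
  apply: (sphere_max_zero N0 r0 trigpoly_damped _ Fx Fz xy zw) => u ur.
  by apply: xmax; rewrite le_enorm_dot.
exists x; split=> // [|z Pz zr]; last first.
  have lift u : enorm u <= r -> enorm u ^+ 2 + Num.sqrt (r ^+ 2 - enorm u ^+ 2) ^+ 2 = r ^+ 2.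
    move=> ur; rewrite sqr_sqrtr; first by rewrite addrC subrK.
    by rewrite subr_ge0 lerXn2r ?nnegrE ?enorm_ge0.
  apply: (separation z _ _ _ (lift _ x xr) (lift _ z zr)).
  by rewrite /damped Pz mul0r.
(* b is the angle of the lift of x from the pole. *)
have [b bE] : exists b, b = asin (enorm x / r) by eexists.
have xr1 : -1 <= enorm x / r <= 1.
  rewrite ler_pdivrMr // mul1r xr andbT.
  by apply: (@le_trans _ _ 0); rewrite ?divr_ge0 ?enorm_ge0 //; lra.
have sinb : r * sin b = enorm x by rewrite bE asinK ?in_itv //= mulrC mulfVK ?gt_eqF.
have b1 : b <= pi / 2 by rewrite bE asin_lepi2.
apply: le_trans (cap_radius_le R n0 m0).
rewrite leNgt; apply/negP => x_far.
have c0 := cap_angle_gt0 R n0 m0.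
have bc : cap_angle R n m <= b.
  rewrite leNgt; apply/negP => bc.
  have : enorm x <= r * cap_angle R n m; last by lra.
  rewrite -sinb ler_pM2l //.
  have [b_ge0|b_lt0] := lerP 0 b; first by rewrite (le_trans (sin_le_id b_ge0)) // ltW.
  have bN : - (pi / 2) <= b by rewrite bE asin_geNpi2.
  have : sin b <= sin 0; last by rewrite sin0; lra.
  by rewrite ltW // ltr_sin ?in_itv /=; have := @pi_gt0 R; lra.
have [j jm hj] : exists2 j, (j < m)%N & `|b - plank_center R n m j| <= plank_width R n m.
  by apply: plank_cover => //; rewrite bc.
have /andP [th0 th1] := plank_center_in R n0 m0 jm.
have [th thE] : exists th, th = plank_center R n m j by eexists.
rewrite -thE in hj th0 th1.
have x0 : 0 < enorm x by apply: lt_trans x_far; rewrite mulr_gt0.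
have sth : 0 < sin th by apply: sin_gt0_pihalf; rewrite th0.
pose z := (r * sin th / enorm x) *: x.
have zz : enorm z ^+ 2 = (r * sin th) ^+ 2.
  by rewrite sqr_enorm dotZl dotZr -sqr_enorm; field; rewrite gt_eqF.
have xz : dot x z = r * sin th * enorm x.
  by rewrite dotZr -sqr_enorm; field; rewrite gt_eqF.
have Fz : damped z = 0.
  rewrite /damped /quad_prod (bigD1 (Ordinal jm)) //= zz /plank_coef -thE.
  by rewrite mulVf ?subrr ?mul0r ?mulr0 // expf_neq0 // gt_eqF // mulr_gt0.
have := separation z (r * cos b) (r * cos th) Fz.
rewrite -sinb zz.
have pyth a : (r * sin a) ^+ 2 + (r * cos a) ^+ 2 = r ^+ 2.
  by rewrite !exprMn -mulrDr addrC cos2Dsin2 mulr1.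
move=> /(_ (pyth b) (pyth th)); rewrite xz -sinb.
have -> : r * sin th * (r * sin b) + r * cos b * (r * cos th) =
    r ^+ 2 * cos (b - th) by rewrite cosB; ring.
rewrite ler_pM2l ?exprn_gt0 // leNgt => /negP; apply.
rewrite -(cos_norm (b - th)) ltr_cos ?in_itv /= ?normr_ge0.
- exact: le_lt_trans hj (plank_width_lt R n0 m0).
- rewrite /= ler_norml; apply/andP; split; have := @pi_gt0 R; lra.
- by rewrite ltW ?circ_gap_gt0 //= circ_gap_le_pi.
Qed.

End SphereStage.

(** * The flat limit *)

(** The squared chord between the lifts is at least
    2 r^2 (1 - cos a) = 4 r^2 (sin (a / 2))^2.  It exceeds the squared distance
    of the projections by the square of the difference of the heights, and that
    difference is O(1 / r), because the heights differ by
    (|z|^2 - |x|^2) / (y + w) and y is at least r / 2. *)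
Lemma lift_distance (R : realType) (d : nat) (x z : 'rV[R]_d) (r a : R) :
  4 <= r -> 0 < a <= pi -> enorm x <= 2 -> enorm z <= r ->
  dot x z + Num.sqrt (r ^+ 2 - enorm x ^+ 2) * Num.sqrt (r ^+ 2 - enorm z ^+ 2)
    <= r ^+ 2 * cos a ->
  (r * a) ^+ 2 * cos (a / 2) ^+ 2 - 4 * (enorm z ^+ 2 + 4) ^+ 2 * r^-1 ^+ 2
    <= enorm (x - z) ^+ 2.
Proof.
move=> r4 /andP [a0 api] x2 zr.
have r0 : 0 < r by lra.
have X0 := enorm_ge0 x; have Z0 := enorm_ge0 z.
have xx : enorm x ^+ 2 <= 4.
  have : enorm x ^+ 2 <= 2 ^+ 2 by rewrite lerXn2r ?nnegrE.
  lra.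
have r16 : 16 <= r ^+ 2.
  have : 4 ^+ 2 <= r ^+ 2 by rewrite lerXn2r ?nnegrE //; lra.
  lra.
set y := Num.sqrt (r ^+ 2 - _); set w := Num.sqrt _ => sep.
have y2 : y ^+ 2 = r ^+ 2 - enorm x ^+ 2 by rewrite sqr_sqrtr //; lra.
have w2 : w ^+ 2 = r ^+ 2 - enorm z ^+ 2.
  by rewrite sqr_sqrtr // subr_ge0 lerXn2r ?nnegrE // ltW.
have y0 : 0 <= y by exact: sqrtr_ge0.
have w0 : 0 <= w by exact: sqrtr_ge0.
clearbody y w.
have yr : r / 2 <= y + w.
  apply: le_trans (_ : y <= _); last by rewrite lerDl.
  by rewrite -ler_sqr ?nnegrE ?divr_ge0 ?(ltW r0) // y2 exprMn; lra.
have distE : enorm (x - z) ^+ 2 + (y - w) ^+ 2 = 2 * (r ^+ 2 - (dot x z + y * w)).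
  rewrite sqr_enorm !(dotDl, dotDr, dotNl, dotNr) (dotC z x) -!sqr_enorm.
  have -> : (y - w) ^+ 2 = y ^+ 2 + w ^+ 2 - 2 * (y * w) by ring.
  by rewrite y2 w2; ring.
have gap : (y - w) ^+ 2 <= 4 * (enorm z ^+ 2 + 4) ^+ 2 * r^-1 ^+ 2.
  rewrite exprVn ler_pdivlMr ?exprn_gt0 //.
  have h1 : (y - w) ^+ 2 * (r / 2) ^+ 2 <= (y - w) ^+ 2 * (y + w) ^+ 2.
    rewrite ler_wpM2l ?sqr_ge0 // lerXn2r ?nnegrE ?divr_ge0 ?addr_ge0 ?(ltW r0) //.
  have h2 : (y - w) ^+ 2 * (y + w) ^+ 2 = (enorm z ^+ 2 - enorm x ^+ 2) ^+ 2.
    have -> : (y - w) ^+ 2 * (y + w) ^+ 2 = (y ^+ 2 - w ^+ 2) ^+ 2 by ring.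
    by rewrite y2 w2; ring.
  have h3 : (enorm z ^+ 2 - enorm x ^+ 2) ^+ 2 <= (enorm z ^+ 2 + 4) ^+ 2.
    rewrite -real_normK ?num_real // lerXn2r ?nnegrE //.
      by rewrite addr_ge0 ?sqr_ge0.
    apply: (le_trans (ler_normB _ _)); rewrite !ger0_norm ?sqr_ge0 //; lra.
  have -> : (y - w) ^+ 2 * r ^+ 2 = 4 * ((y - w) ^+ 2 * (r / 2) ^+ 2) by field.
  by rewrite ler_pM2l //; rewrite h2 in h1; exact: le_trans h1 h3.
have chord : (r * a) ^+ 2 * cos (a / 2) ^+ 2 <= 2 * (r ^+ 2 - r ^+ 2 * cos a).
  have aE : a = (a / 2) *+ 2 by rewrite -mulr_natr; field.
  have [b bE] : exists b, b = a / 2 by eexists.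
  rewrite -bE in aE *; rewrite aE cos_mulr2n.
  have pi0 := @pi_gt0 R.
  have cb : 0 <= cos b by apply: cos_ge0_pihalf; lra.
  have : (b * cos b) ^+ 2 <= sin b ^+ 2.
    have sb : b * cos b <= sin b by apply: sin_ge_mul_cos; lra.
    have bb : 0 <= b * cos b by rewrite mulr_ge0 //; lra.
    by rewrite lerXn2r ?nnegrE // (le_trans bb).
  rewrite sin2cos2 => h.
  have -> : (r * (b *+ 2)) ^+ 2 * cos b ^+ 2 = 4 * r ^+ 2 * (b * cos b) ^+ 2 by ring.
  have -> : 2 * (r ^+ 2 - r ^+ 2 * (cos b ^+ 2 *+ 2 - 1)) = 4 * r ^+ 2 * (1 - cos b ^+ 2).
    by ring.
  by rewrite ler_wpM2l // mulr_ge0 ?sqr_ge0.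
lra.
Qed.

Section Limit.
Variables (R : realType) (n : nat).
Hypothesis n0 : (0 < n)%N.

Lemma cvg_circ_gap : (circ_gap R n @ \oo --> (0 : R))%classic.
Proof.
have h : ((fun m => pi * (m.+1%:R)^-1) @ \oo --> (pi * 0 : R))%classic.
  by apply: cvgM; [exact: cvg_cst|exact: cvg_harmonic].
rewrite mulr0 in h.
apply: squeeze_cvgr (cvg_cst 0) h; apply: nearW => m.
have pi0 := @pi_gt0 R.
have N1 : m.+1%:R <= 2 * (circ_degree n m)%:R :> R.
  by rewrite -natrM ler_nat /circ_degree; lia.
have m1 : 0 < m.+1%:R :> R by rewrite ltr0n.
apply/andP; split; first by rewrite divr_ge0 ?(ltW pi0) // mulr_ge0.
by rewrite ler_pM2l // lef_pV2 ?posrE // (lt_le_trans m1).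
Qed.

Lemma cvg_circ_degreeV : ((fun m => (circ_degree n m)%:R^-1) @ \oo --> (0 : R))%classic.
Proof.
apply: squeeze_cvgr (cvg_cst 0) (@cvg_harmonic R); apply: nearW => m.
have N1 : m.+1%:R <= (circ_degree n m)%:R :> R by rewrite ler_nat /circ_degree; lia.
have m1 : 0 < m.+1%:R :> R by rewrite ltr0n.
by rewrite invr_ge0 ler0n /= lef_pV2 ?posrE // (lt_le_trans m1).
Qed.

Lemma cvg_sphere_radiusV : ((fun m => (sphere_radius R n m)^-1) @ \oo --> (0 : R))%classic.
Proof.
have h : ((fun m => n%:R * circ_gap R n m) @ \oo --> (n%:R * 0 : R))%classic.
  by apply: cvgM; [exact: cvg_cst|exact: cvg_circ_gap].
rewrite mulr0 in h.
by apply: cvg_trans h; apply: near_eq_cvg; apply: nearW => m; rewrite /sphere_radius invrK.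
Qed.

Lemma sphere_radius_large (M : R) : (\forall m \near \oo, M <= sphere_radius R n m)%classic.
Proof.
have M0 : 0 < (`|M| + 1)^-1 by rewrite invr_gt0 ltr_wpDl.
move/cvgrPdist_le: cvg_sphere_radiusV => /(_ _ M0) small.
apply: filterS2 small (nbhs_infty_gt 0%N) => m + m0.
have r0 := sphere_radius_gt0 R n0 m0.
have rV : 0 <= (sphere_radius R n m)^-1 by rewrite invr_ge0 ltW.
rewrite sub0r normrN (ger0_norm rV) lef_pV2 ?posrE ?ltr_wpDl //.
by have := ler_norm M; lra.
Qed.

End Limit.

Unset Implicit Arguments.

(* [msize P] is one more than the total degree of [P] when [P] is nonzero. *)
Theorem theorem1p5 (R : realType) :
  exists G : nat -> R -> R,
    (forall n : nat, (1 <= n)%N ->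
       even_function (G n) /\ real_analytic (G n)) /\
    (forall (d n : nat) (P : {mpoly R[d]}),
       (1 <= d)%N -> (1 <= n)%N -> P != 0 -> msize P = n.+1 ->
       exists x : 'rV[R]_d,
         attains_max_on (@unit_ball R d)
           (fun y => `|peval P y * G n (enorm y)|) x /\
         dist_from_ge (n%:R^-1) x (zero_set P)).
Proof.
have [U [UU ooU]] := @ultraFilterLemma nat \oo%classic _.
have UP : ProperFilter U by exact: ultra_proper.
have toU (T : topologicalType) (u : nat -> T) (l : T) :
    (u @ \oo --> l)%classic -> (u @ U --> l)%classic.
  by move=> ul A lA; apply: ooU; exact: ul.
have posU : \forall m \near U, (0 < m)%N by apply: ooU; exact: nbhs_infty_gt.
have [G GP] : {G : nat -> R -> R & forall n, (0 < n)%N ->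
    [/\ even_function (G n), real_analytic (G n) &
    forall (t : nat -> R) (s : R), (t @ U --> s)%classic ->
      ((fun m => quad_prod (plank_coef R n m) m (t m)) @ U --> G n s)%classic]}.
  apply: (@boolp.choice _ _ (fun n g => (0 < n)%N ->
    [/\ even_function g, real_analytic g &
    forall (t : nat -> R) (s : R), (t @ U --> s)%classic ->
      ((fun m => quad_prod (plank_coef R n m) m (t m)) @ U --> g s)%classic])) => n.
  case: (posnP n) => [->|n0]; first by exists (fun=> 0).
  have [g gP] := @ultra_quad_prod_limit R U (plank_coef R n) _ UU
    (plank_coef_ge0 R n) (fun m => sum_plank_coef_le R m n0).
  by exists g.
exists G; split=> [n n1|d n P _ n0 P0 sP]; first by case: (GP n n1).
have [_ _ Glim] := GP n n0.
have [x xP] : {x : nat -> 'rV[R]_d & forall m, (0 < m)%N ->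
    near_unit_maximizer n m P (x m)}.
  apply: (@boolp.choice _ _ (fun m u => (0 < m)%N -> near_unit_maximizer n m P u)) => m.
  case: (posnP m) => [->|m0]; first by exists 0.
  by have [u uP] := near_unit_maximizer_exists n0 m0 P0 sP; exists u.
have x_le2 : \forall m \near U, enorm (x m) <= 2.
  move: posU; apply: filterS => m m0; have [h _ _] := xP m m0.
  apply: (le_trans h); rewrite -[leRHS]/(1 + 1) lerD2l invf_le1 ?ler1n ?ltr0n.
  - by rewrite addn_gt0 n0.
  - by rewrite addn_gt0 n0.
have [x0 _ xx0] := ultra_cvg_compact UU (@compact_enorm_ball R d 2) x_le2.
have Nx0 : ((fun m => enorm (x m)) @ U --> enorm x0)%classic by exact: cvg_enorm.
have large M : \forall m \near U, M <= sphere_radius R n m.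
  by apply: ooU; exact: sphere_radius_large.
(* The limit along U of the maximum points on the spheres. *)
exists x0; split; first split.
- have lim1 : ((fun m => 1 + (circ_degree n m)%:R^-1) @ U --> (1 + 0 : R))%classic.
    by apply: cvgD; [exact: cvg_cst|apply: toU; exact: cvg_circ_degreeV].
  rewrite addr0 in lim1; apply: (ler_cvg_to Nx0 lim1).
  by move: posU; apply: filterS => m m0; case: (xP m m0).
- move=> y y1.
  have damped_lim (u : nat -> 'rV[R]_d) v : (u @ U --> v)%classic ->
      ((fun m => `|damped n m P (u m)|) @ U --> `|peval P v * G n (enorm v)|)%classic.
    move=> uv; apply: cvg_norm; apply: cvgM; first exact: cvg_peval.
    by apply: Glim; exact: cvg_enorm.
  apply: (ler_cvg_to (damped_lim (fun=> y) y (cvg_cst y)) (damped_lim x x0 xx0)).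
  apply: filterS2 posU (large 1) => m m0 r1.
  by have [_ h _] := xP m m0; apply: h; apply: le_trans r1.
move=> z Pz.
have nR : 0 < n%:R :> R by rewrite ltr0n.
have dist_lim : ((fun m => enorm (x m - z) ^+ 2) @ U --> enorm (x0 - z) ^+ 2)%classic.
  have xz : ((fun m => enorm (x m - z)) @ U --> enorm (x0 - z))%classic.
    by apply: cvg_enorm; apply: cvgB => //; exact: cvg_cst.
  exact: (continuous_cvg _ (@exprn_continuous R 2 _) xz).
have half_gap : ((fun m => cos (circ_gap R n m / 2)) @ U --> (1 : R))%classic.
  have h : ((fun m => circ_gap R n m / 2) @ U --> (0 / 2 : R))%classic.
    by apply: cvgM; [apply: toU; exact: cvg_circ_gap|exact: cvg_cst].
  by have := continuous_cvg _ (@continuous_cos R _) h; rewrite mul0r trigo.cos0; apply.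
have half_gap2 : ((fun m => cos (circ_gap R n m / 2) ^+ 2) @ U --> (1 ^+ 2 : R))%classic.
  exact: (continuous_cvg _ (@exprn_continuous R 2 _) half_gap).
have rV2 : ((fun m => (sphere_radius R n m)^-1 ^+ 2) @ U --> (0 ^+ 2 : R))%classic.
  apply: (continuous_cvg _ (@exprn_continuous R 2 _)).
  by apply: toU; exact: cvg_sphere_radiusV.
have low_lim : ((fun m => n%:R^-1 ^+ 2 * cos (circ_gap R n m / 2) ^+ 2 -
    4 * (enorm z ^+ 2 + 4) ^+ 2 * (sphere_radius R n m)^-1 ^+ 2) @ U -->
    (n%:R^-1 ^+ 2 * 1 ^+ 2 - 4 * (enorm z ^+ 2 + 4) ^+ 2 * 0 ^+ 2 : R))%classic.
  by apply: cvgB; apply: cvgM => //; exact: cvg_cst.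
rewrite expr1n mulr1 expr0n /= mulr0 subr0 in low_lim.
rewrite -ler_sqr ?nnegrE ?enorm_ge0 ?invr_ge0 ?(ltW nR) //.
apply: (ler_cvg_to low_lim dist_lim).
apply: filterS3 posU x_le2 (large (Num.max 4 (enorm z))) => m m0 x2.
rewrite ge_max => /andP [r4 rz].
have [_ _ sep] := xP m m0.
have gap0 := circ_gap_gt0 R n0 m0.
have rgap : sphere_radius R n m * circ_gap R n m = n%:R^-1.
  by rewrite /sphere_radius; field; rewrite !gt_eqF.
rewrite -rgap; apply: lift_distance => //; last exact: sep.
by rewrite gap0 circ_gap_le_pi.
Qed.
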